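(* Let $n,k$ be integers with $1\le k\le n-1$ and let $G\in\mathbb{V}_n^k$, i.e. $G$ is a connected simple graph with $n$ vertices and vertex connectivity $\kappa(G)\le k$. Then $$\prod\nolimits_1(G)\le k^2\,(n-1)^{2k}\,(n-2)^{2(n-k-1)}\quad\text{and}\quad \prod\nolimits_2(G)\le k^k\,(n-1)^{k(n-1)}\,(n-2)^{(n-2)(n-k-1)},$$ and in each of the two inequalities equality holds if and only if $G\cong K_n^k$.
   Context: All graphs are finite, simple and connected. $d(u)$ is the degree of a vertex $u$. The first and second multiplicative Zagreb indices are $\prod_1(G)=\prod_{u\in V(G)}d(u)^2$ and $\prod_2(G)=\prod_{uv\in E(G)}d(u)d(v)=\prod_{u\in V(G)}d(u)^{d(u)}$. The convention $0^0=1$ is used. A graph is $k$-connected ($k\ge1$) if it is either the complete graph $K_{k+1}$, or has at least $k+2$ vertices and has no vertex cut of size $k-1$; $\kappa(G)$ is the largest $k$ for which $G$ is $k$-connected (so $\kappa(K_n)=n-1$). $\mathbb{V}_n^k$ is the set of connected graphs with $n$ vertices and $\kappa(G)\le k\le n-1$. $K_n^k$ is the graph obtained from the complete graph $K_{n-1}$ by adding one new vertex and joining it to exactly $k$ vertices of $K_{n-1}$. *)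

(* Defs.v *)
From mathcomp Require Import all_boot.

Set Implicit Arguments.
Unset Strict Implicit.
Unset Printing Implicit Defensive.

Record sgraph := SGraph {
  vertex :> finType;
  edge : rel vertex;
  edge_sym : symmetric edge;
  edge_irrefl : irreflexive edge }.

Definition sg_iso (G H : sgraph) : Prop :=
  exists f : G -> H, bijective f /\ forall u v : G, edge (f u) (f v) = edge u v.

Definition connected (G : sgraph) : bool :=
  [forall u : G, forall v : G, connect (@edge G) u v].

Definition degree (G : sgraph) (u : G) : nat := #|[set v : G | edge u v]|.

(* An edge is the two-element set of its ends, so each edge is counted once. *)
Definition edge_set (G : sgraph) : {set {set G}} :=
  [set [set p.1; p.2] | p : G * G & edge p.1 p.2].

Definition zagreb1 (G : sgraph) : nat := \prod_(u : G) degree u ^ 2.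

Definition zagreb2 (G : sgraph) : nat :=
  \prod_(e in edge_set G) \prod_(u in e) degree u.

Section DeleteVertices.
Variables (G : sgraph) (S : {set G}).

Definition del_edge : rel {u : G | u \notin S} :=
  [rel u v | edge (val u) (val v)].

Lemma del_edge_sym : symmetric del_edge.
Proof. by move=> u v; apply: edge_sym. Qed.

Lemma del_edge_irrefl : irreflexive del_edge.
Proof. by move=> u; apply: edge_irrefl. Qed.

Definition del_vertices : sgraph := SGraph del_edge_sym del_edge_irrefl.

End DeleteVertices.

Definition vertex_cut (G : sgraph) (S : {set G}) : bool :=
  ~~ connected (del_vertices S).

Definition complete (G : sgraph) : bool :=
  [forall u : G, forall v : G, (u != v) ==> edge u v].

Definition k_connected (k : nat) (G : sgraph) : bool :=
  (1 <= k) &&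
  ((#|G| == k.+1) && complete G
   || (k.+2 <= #|G|) && [forall S : {set G}, (#|S| == k - 1) ==> ~~ vertex_cut S]).

(* A k-connected graph has at least k + 1 vertices, so the bound on k loses
   nothing; the value is 0 when G is k-connected for no k >= 1. *)
Definition kappa (G : sgraph) : nat :=
  \max_(k < #|G| | k_connected k G) k.

Definition in_V (n k : nat) (G : sgraph) : Prop :=
  [/\ connected G, #|G| = n & kappa G <= k].

Section AddVertex.
Variables n k : nat.

(* [Some i] are the vertices of the complete graph on n - 1 vertices; the added
   vertex [None] is joined to the k vertices i < k (when k <= n - 1). *)
Definition Kedge : rel (option 'I_(n - 1)) := fun u v =>
  match u, v with
  | Some i, Some j => i != j
  | Some i, None | None, Some i => i < k
  | None, None => false
  end.

Lemma Kedge_sym : symmetric Kedge.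
Proof. by case=> [i|] [j|] //=; rewrite eq_sym. Qed.

Lemma Kedge_irrefl : irreflexive Kedge.
Proof. by case=> [i|] //=; rewrite eqxx. Qed.

Definition Knk : sgraph := SGraph Kedge_sym Kedge_irrefl.

End AddVertex.

(* Main.v *)
Require Import Defs.
From mathcomp Require Import all_boot.
From mathcomp Require Import zify.

(** If k = n - 1 the bounds only say that degrees are at most n - 1.  If
    k < n - 1 and kappa G <= k, some set S of k vertices splits the
    remaining ones into non-empty parts A and B with no edge between them, so
    the degree of a vertex is at most n - 1 on S, k + |A| - 1 on A and
    k + |B| - 1 on B.  Both indices have the form [\prod_u h (degree u)], with
    [h x = x ^ 2] or [h x = x ^ x], and for both h a convexity inequality shows
    that the resulting bound is largest exactly when A or B is a singleton.
    Equality then forces every vertex to have all the neighbours that the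
    partition allows, which is the graph Knk. *)

(** * Inequalities between powers *)

(** Bernoulli's inequality for [1 + y / x], with denominators cleared. *)
Lemma bernoulli_expn (x y n : nat) :
  x ^ n * (x + n.+1 * y) <= (x + y) ^ n.+1.
Proof.
elim: n => [|n IHn]; first by rewrite expn0 expn1 !mul1n.
rewrite [(x + y) ^ n.+2]expnS; apply: leq_trans (leq_mul (leqnn _) IHn).
rewrite expnS; set z := x ^ n; nia.
Qed.

Lemma leq_expn2r (m n e : nat) : m <= n -> m ^ e <= n ^ e.
Proof. by case: e => // e le_mn; rewrite leq_exp2r. Qed.

(* With m = a + b - 1, Bernoulli bounds (c + m) ^ b.+1 from below by
   (c + b) ^ b * (c + b + b.+1 * (a - 1)); what remains is quadratic. *)
Lemma expn_convex (c a b : nat) : 2 <= a <= b ->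
  (c + a) ^ a * (c + b) ^ b < (c + 1) * (c + (a + b - 1)) ^ (a + b - 1).
Proof.
case: a => [|[|a]] // /andP[_ le_ab].
have -> : a.+2 + b - 1 = a + b.+1 by lia.
have le_pow : (c + a.+2) ^ a <= (c + (a + b.+1)) ^ a by apply: leq_expn2r; lia.
have pos_pow : 0 < (c + (a + b.+1)) ^ a by rewrite expn_gt0; lia.
have pos_b : 0 < (c + b) ^ b by rewrite expn_gt0; lia.
have bern := bernoulli_expn (c + b) a.+1 b.
rewrite (_ : c + b + a.+1 = c + (a + b.+1)) in bern; last by lia.
(* All but two of the [a.+2] factors [c + a.+2] are absorbed by [le_pow]; the other two are compared
   with the linear factor of [bern]. With [b = a.+2 + d] the difference is an explicit sum whose
   last term [a.+1] makes it positive. *)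
have key : (c + a.+2) ^ 2 < (c + 1) * (c + b + b.+1 * a.+1).
  rewrite -(subnKC le_ab); set d := b - _.
  have -> : (c + 1) * (c + (a.+2 + d) + (a.+2 + d).+1 * a.+1)
          = (c + a.+2) ^ 2 + (c * (a.+2 * (a + 1 + d)) + a.+2 * d + a.+1).
    by rewrite -mulnn; lia.
  by rewrite -[X in X < _]addn0 ltn_add2l addnS.
have -> : (c + a.+2) ^ a.+2 = (c + a.+2) ^ 2 * (c + a.+2) ^ a by rewrite -expnD.
rewrite expnD.
set p := (c + a.+2) ^ a in le_pow *.
set q := (c + (a + b.+1)) ^ a in le_pow pos_pow *.
set r := (c + b) ^ b in bern pos_b *.
set s := (c + (a + b.+1)) ^ b.+1 in bern *.
apply: (@leq_ltn_trans (q * ((c + a.+2) ^ 2 * r))).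
  by rewrite -mulnA mulnCA leq_mul2r le_pow orbT.
rewrite [_ * (q * s)]mulnCA ltn_pmul2l //.
apply: (@leq_trans ((c + 1) * (r * (c + b + b.+1 * a.+1)))).
  by rewrite mulnCA mulnC ltn_pmul2l.
by rewrite leq_mul2l bern orbT.
Qed.

(* Writing F x = (c + x) ^ x, the terms are F x ^ (c + x): raise the inequality
   F a * F b < F 1 * F m of [expn_convex] to the power c + a, then use
   F b <= F m and F 1 <= F m for the remaining b - a and a - 1 factors. *)
Lemma expn_self_convex (c a b : nat) : 2 <= a <= b ->
  ((c + a) ^ (c + a)) ^ a * ((c + b) ^ (c + b)) ^ b
  < (c + 1) ^ (c + 1)
    * ((c + (a + b - 1)) ^ (c + (a + b - 1))) ^ (a + b - 1).
Proof.
move=> le_ab; rewrite -!expnM ![(c + _) * _]mulnC !expnM.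
move: (expn_convex c a b le_ab); move: le_ab => /andP[a2 le_ab].
set m := a + b - 1.
set A := (c + a) ^ a; set B := (c + b) ^ b; set M := (c + m) ^ m => lt_AB.
have m1 : 0 < m by lia.
have B_gt0 : 0 < B by rewrite expn_gt0; lia.
have le_BM : B <= M.
  apply: (@leq_trans ((c + m) ^ b)); first by rewrite leq_exp2r; lia.
  by rewrite leq_pexp2l; lia.
have le_1M : c + 1 <= M.
  apply: (@leq_trans (c + m)); first by lia.
  by rewrite -{1}[c + m]expn1 leq_pexp2l; lia.
clearbody A B M.
apply: (@leq_trans (((c + 1) * M) ^ (c + a) * M ^ (b - a))).
  apply: (@leq_trans (((c + 1) * M) ^ (c + a) * B ^ (b - a))).
    have -> : c + b = c + a + (b - a) by lia.
    rewrite [B ^ _]expnD mulnA -expnMn ltn_pmul2r.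
      by rewrite ltn_exp2r //; lia.
    by rewrite expn_gt0 B_gt0.
  by rewrite leq_mul2l leq_expn2r ?orbT.
have -> : c + m = (a - 1) + (c + a + (b - a)) by lia.
have {1}-> : c + a = (c + 1) + (a - 1) by lia.
rewrite expnMn -mulnA -expnD expnD -mulnA leq_mul2l; apply/orP; right.
rewrite [M ^ (a - 1 + _)]expnD (_ : _ + _ + (b - a) = c + a + (b - a)); last by lia.
by rewrite leq_mul2r leq_expn2r ?orbT.
Qed.

(** * Finite products and sums *)

(** One strictly smaller factor would make the whole product strictly smaller, because the product
    of the other [f j] is positive. *)
Lemma leq_prod_eq (I : finType) (f g : I -> nat) :
  (forall i, 0 < f i) -> (forall i, f i <= g i) ->
  \prod_i f i = \prod_i g i -> forall i, f i = g i.
Proof.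
move=> f_gt0 le_fg eq_fg i; apply/eqP; rewrite eqn_leq le_fg leqNgt.
apply/negP => lt_i; move: eq_fg; rewrite (bigD1 i) // [RHS](bigD1 i) //= => eq_fg.
have le_prod : \prod_(j | j != i) f j <= \prod_(j | j != i) g j by apply: leq_prod.
have prod_gt0 : 0 < \prod_(j | j != i) f j by apply: prodn_cond_gt0.
by move: lt_i; rewrite ltnNge; nia.
Qed.

Lemma big_option (R : Type) (idx : R) (op : Monoid.com_law idx)
    (I : finType) (F : option I -> R) :
  \big[op/idx]_(u : option I) F u
  = op (F None) (\big[op/idx]_(i : I) F (Some i)).
Proof.
rewrite (bigD1 None) //=; congr (op _ _).
rewrite (reindex_omap Some id) /=; last by case.
by apply: eq_bigl => i; rewrite eqxx.
Qed.

Lemma card_ord_ltn (m k : nat) : k <= m -> #|[pred i : 'I_m | i < k]| = k.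
Proof.
move=> le_km; rewrite -sum1_card -(big_ord_widen _ (fun=> 1)) //.
by rewrite sum1_card card_ord.
Qed.

(** * Degrees in [Knk] and recognition of this graph *)

Lemma degree_sum (G : sgraph) (u : G) : degree u = \sum_(v : G) edge u v.
Proof. by rewrite /degree -sum1dep_card big_mkcond. Qed.

Lemma degree_Knk_None (n k : nat) : k <= n - 1 -> @degree (Knk n k) None = k.
Proof.
move=> le_kn; rewrite degree_sum big_option /= add0n.
by rewrite -[RHS](card_ord_ltn (n - 1) k) // -sum1_card [RHS]big_mkcond.
Qed.

Lemma degree_Knk_Some (n k : nat) (i : 'I_(n - 1)) :
  @degree (Knk n k) (Some i) = (i < k) + (n - 2).
Proof.
rewrite degree_sum big_option /=; congr (_ + _).
rewrite (_ : n - 2 = (n - 1).-1); last by lia.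
rewrite -[n - 1 in RHS]card_ord -(cardC1 i) -sum1_card [RHS]big_mkcond.
by apply: eq_bigr => j _; rewrite inE eq_sym; case: eqP.
Qed.

(* The vertices are numbered with the neighbours of w first and w last; the
   number n - 1 of w is out of range, so [insub] sends w to [None]. *)
Lemma sg_iso_Knk (n k : nat) (G : sgraph) (w : G) :
  #|G| = n -> degree w = k ->
  (forall u v : G, u != w -> v != w -> u != v -> edge u v) ->
  sg_iso G (Knk n k).
Proof.
move=> cardG deg_w clique; pose N := [set v | edge w v].
pose s := enum N ++ enum (~: (w |: N)).
have wN : w \notin N by rewrite inE edge_irrefl.
have cardN : #|N| = k by [].
have mem_s v : (v \in s) = (v != w).
  rewrite mem_cat !mem_enum !inE negb_or.
  by case: eqVneq => [->|_]; rewrite ?edge_irrefl //= orbN.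
have size_s : size s = n - 1.
  rewrite size_cat -!cardE; have := cardsC (w |: N).
  by rewrite cardsU1 wN cardG; lia.
pose f u : Knk n k := insub (index u s).
have f_w : f w = None.
  by rewrite /f insubF // -size_s index_mem mem_s eqxx.
have f_val u : u != w -> exists2 i : 'I_(n - 1), f u = Some i & i < k = edge w u.
  move=> uw; have lt_u : index u s < n - 1 by rewrite -size_s index_mem mem_s.
  exists (Ordinal lt_u); first by rewrite /f insubT.
  rewrite /= index_cat mem_enum inE; case: ifP => wu.
    by rewrite -cardN cardE index_mem mem_enum inE wu.
  by rewrite -cardE cardN ltnNge leq_addr.
have f_inj : injective f.
  move=> u v; rewrite /f => eq_f; have eq_i : index u s = index v s.
    move: eq_f; case: insubP => [i _ <-|]; case: insubP => [j _ <-|] //.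
      by move=> [->].
    (* If both images are [None], both indices are at least [size s], the largest value of [index],
       so they agree. *)
    move=> + + _; rewrite -size_s -!leqNgt => le_v le_u; apply/eqP.
    by rewrite eqn_leq !(leq_trans (index_size _ _)).
  have [uw|uw] := eqVneq u w; last first.
    have us : u \in s by rewrite mem_s.
    by rewrite -(nth_index w us) eq_i nth_index // -index_mem -eq_i index_mem.
  have : v \notin s by rewrite -index_mem -eq_i index_mem mem_s uw eqxx.
  by rewrite mem_s negbK uw => /eqP.
have le_card : #|Knk n k| <= #|G|.
  by rewrite card_option card_ord; have : 0 < #|G| by [apply/card_gt0P; exists w]; lia.
exists f; split; first exact: inj_card_bij.
move=> u v; have [->|uw] := eqVneq u w; have [->|vw] := eqVneq v w.
- by rewrite f_w !edge_irrefl.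
- by have [j -> <-] := f_val v vw; rewrite f_w.
- by have [i -> lt_i] := f_val u uw; rewrite f_w [RHS]edge_sym -lt_i.
have [i fu _] := f_val u uw; have [j fv _] := f_val v vw.
rewrite fu fv /=; have [eq_uv|uv] := eqVneq u v.
  by move: fu; rewrite eq_uv fv edge_irrefl => -[->]; rewrite eqxx.
rewrite (clique u v) //; apply/negP => /eqP eq_ij.
by move/eqP: uv; apply; apply: f_inj; rewrite fu fv eq_ij.
Qed.

(** * Products of a function [h] over the degrees *)

Section DegreeProduct.

Variable h : nat -> nat.
(** The arguments are restricted to [0 < x] because [x ^ 2] vanishes at 0 and [x ^ x] takes the
    value 1 at both 0 and 1. *)
Hypothesis h_gt0 : forall x, 0 < x -> 0 < h x.
Hypothesis h_mono : forall x y, 0 < x -> x < y -> h x < h y.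
Hypothesis h_convex : forall c a b, 2 <= a <= b ->
  h (c + a) ^ a * h (c + b) ^ b
  < h (c + 1) * h (c + (a + b - 1)) ^ (a + b - 1).

Lemma leq_homo (x y : nat) : 0 < x -> x <= y -> h x <= h y.
Proof.
by move=> x0; rewrite leq_eqVlt => /predU1P[-> //|/(h_mono _ _ x0)/ltnW].
Qed.

Lemma homo_inj (x y : nat) : 0 < x -> x <= y -> h x = h y -> x = y.
Proof.
move=> x0; rewrite leq_eqVlt => /predU1P[-> //|/(h_mono _ _ x0) lt_h eq_h].
by rewrite eq_h ltnn in lt_h.
Qed.

Lemma two_block_leq (c a b : nat) : 0 < a <= b ->
  h (c + a) ^ a * h (c + b) ^ b
  <= h (c + 1) * h (c + (a + b - 1)) ^ (a + b - 1)
     ?= iff (a == 1).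
Proof.
case/andP; rewrite leq_eqVlt => /predU1P[<- _ | a_gt1 le_ab].
  by rewrite addKn expn1; apply/leqif_refl.
apply/leqifP; rewrite gtn_eqF //.
by apply: h_convex; rewrite a_gt1.
Qed.

Lemma iso_degree_prod (G H : sgraph) : sg_iso G H ->
  \prod_(u : G) h (degree u) = \prod_(u : H) h (degree u).
Proof.
case=> f [bij_f eq_f]; rewrite [RHS](reindex f) /=; last exact: onW_bij.
apply: eq_bigr => u _; congr h.
rewrite !degree_sum [RHS](reindex f) /=; last exact: onW_bij.
by apply: eq_bigr => v _; rewrite eq_f.
Qed.

Lemma Knk_degree_prod (n k : nat) : k <= n - 1 ->
  \prod_(u : Knk n k) h (degree u)
  = h k * h (n - 1) ^ k * h (n - 2) ^ (n - k - 1).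
Proof.
move=> le_kn; rewrite big_option degree_Knk_None // -mulnA; congr (_ * _).
under eq_bigr do rewrite degree_Knk_Some.
rewrite (bigID [pred i : 'I_(n - 1) | i < k]) /=; congr (_ * _).
  rewrite -[k in RHS](card_ord_ltn (n - 1) k) // -prod_nat_const.
  by apply: eq_bigr => i lt_ik; rewrite lt_ik; congr h; have := ltn_ord i; lia.
have -> : n - k - 1 = #|[predC [pred i : 'I_(n - 1) | i < k]]|.
  have := cardC [pred i : 'I_(n - 1) | i < k].
  rewrite card_ord card_ord_ltn // => /(canRL (addKn k)) ->.
  by rewrite -subnDA addnC subnDA.
by rewrite -prod_nat_const; apply: eq_bigr => i /negPf->.
Qed.

(** Here [A] is the smaller side of the separation. Replacing each degree by the largest value the
    separation allows leaves a product over [S] and two blocks of sizes [a] and [b], to which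
    [two_block_leq] applies. *)
Lemma separation_degree_prod (n k : nat) (G : sgraph) (S A : {set G}) :
  #|G| = n -> 0 < k -> #|S| = k -> [disjoint A & S] ->
  0 < #|A| <= #|~: (S :|: A)| ->
  (forall u v : G, u \in A -> v \notin S :|: A -> ~~ edge u v) ->
  (forall u : G, 0 < degree u) ->
  \prod_(u : G) h (degree u) <= h k * h (n - 1) ^ k * h (n - 2) ^ (n - k - 1)
  /\ (\prod_(u : G) h (degree u)
        = h k * h (n - 1) ^ k * h (n - 2) ^ (n - k - 1)
      -> sg_iso G (Knk n k)).
Proof.
move=> cardG k_gt0 cardS dAS le_AB noE deg_gt0.
set a := #|A| in le_AB *; set b := #|~: _| in le_AB.
have [A_gt0 _] := andP le_AB.
have card_SA : #|S :|: A| = k + a.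
  by have := cardsUI S A; rewrite setIC (disjoint_setI0 dAS) cards0 addn0 cardS.
have card_n : k + a + b = n by rewrite -card_SA cardsC.
have card_CA : #|~: A| = k + b by have := cardsC A; rewrite cardG; lia.
(* [M u] is the largest possible neighbourhood of [u]; [~: A] is [S] together with the other
   side. *)
pose M u := (if u \in S then setT else if u \in A then S :|: A else ~: A) :\ u.
have sub_M u : [set v | edge u v] \subset M u.
  apply/subsetP => v; rewrite inE => uv; rewrite in_setD1.
  have -> : v != u by apply: contraTneq uv => ->; rewrite edge_irrefl.
  case: ifP => [_|uS]; first by rewrite inE.
  case: ifP => uA; first by apply: contraTT uv; apply: noE.
  rewrite inE; apply: contraTN uv => vA; rewrite edge_sym; apply: noE => //.
  by rewrite inE uS uA.
have card_M u : #|M u| = if u \in S then n - 1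
    else if u \in A then k - 1 + a else k - 1 + b.
  rewrite /M; set X := if _ then _ else _; have uX : u \in X.
    by rewrite /X; case: ifP => [|uS]; [|case: ifP => uA]; rewrite !inE ?uA ?orbT.
  have := cardsD1 u X; rewrite uX /X.
  case: ifP => _; first by rewrite cardsT cardG; lia.
  by case: ifP => _; rewrite ?card_SA ?card_CA; lia.
have le_deg u : degree u <= #|M u| by apply: subset_leq_card.
have le_prod : \prod_(u : G) h (degree u) <= \prod_(u : G) h #|M u|.
  by apply: leq_prod => u _; apply: leq_homo.
have prod_M : \prod_(u : G) h #|M u|
    = h (n - 1) ^ k * (h (k - 1 + a) ^ a * h (k - 1 + b) ^ b).
  rewrite (bigID (mem S)) /=; congr (_ * _).
    rewrite -cardS -prod_nat_const; apply: eq_bigr => u uS.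
    by rewrite card_M uS.
  rewrite (bigID (mem A)) /=; congr (_ * _).
    rewrite -prod_nat_const; apply: eq_big => [u|u /andP[/negPf uS uA]].
      by rewrite andb_idl // => uA; rewrite (disjointFr dAS uA).
    by rewrite card_M uS uA.
  rewrite -prod_nat_const; apply: eq_big => [u|u /andP[/negPf uS /negPf uA]].
    by rewrite !inE negb_or.
  by rewrite card_M uS uA.
(* Taking [c = k - 1] turns [c + 1] into [k], as [k] is positive, and [c + (a + b - 1)] into
   [n - 2], as [k + a + b = n]. *)
have [le_conv eq_conv] := two_block_leq (k - 1) a b le_AB.
rewrite [k - 1 + 1]subnK // in le_conv eq_conv.
rewrite (_ : k - 1 + (a + b - 1) = n - 2) in le_conv eq_conv; last by lia.
rewrite (_ : a + b - 1 = n - k - 1) in le_conv eq_conv; last by lia.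
have n1_gt0 : 0 < h (n - 1) ^ k by rewrite expn_gt0 h_gt0 //; lia.
rewrite [h k * _]mulnC -mulnA; rewrite prod_M in le_prod.
split; first by apply: leq_trans le_prod _; rewrite leq_mul2l le_conv orbT.
move=> eq_prod; have le_bound := leq_mul (leqnn (h (n - 1) ^ k)) le_conv.
(* The product over [M] lies between two equal quantities, so [two_block_leq] is an equality and [A]
   is a singleton. *)
have /eqP : h (n - 1) ^ k * (h (k - 1 + a) ^ a * h (k - 1 + b) ^ b)
    == h (n - 1) ^ k * (h k * h (n - 2) ^ (n - k - 1)).
  by rewrite eqn_leq le_bound -eq_prod.
move=> eq_bound; have := eq_bound => /eqP; rewrite eqn_pmul2l // eq_conv => a1.
have [w A_w] := cards1P a1.
(* Equality in [le_prod] forces every degree to attain its bound, so every neighbourhood is all of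
   [M u]. *)
have eq_deg u : degree u = #|M u|.
  apply: homo_inj => //.
  apply: (leq_prod_eq _ (fun u : G => h (degree u)) (fun u => h #|M u|)) => [v|v|].
  - exact: h_gt0.
  - exact: leq_homo.
  by rewrite eq_prod prod_M eq_bound.
have eq_M u : [set v | edge u v] = M u.
  by apply/eqP; rewrite eqEcard sub_M -eq_deg /=.
have wS : w \notin S by rewrite (disjointFr dAS) // A_w inE.
apply: (sg_iso_Knk _ _ _ w) => //.
  rewrite /degree eq_M card_M (negPf wS) A_w inE eqxx.
  by rewrite (eqP a1) subnK.
move=> u v uw vw uv; suff : v \in [set v | edge u v] by rewrite inE.
rewrite eq_M in_setD1 eq_sym uv A_w !inE (negPf uw).
by case: ifP => _; rewrite !inE.
Qed.

End DegreeProduct.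

(** * From bounded connectivity to a separation *)

(** For [x] and [y] not joined after deleting [S], take as [A] the component of [x]; then [y] lies
    on the other side. *)
Lemma vertex_cut_separation (G : sgraph) (S : {set G}) : vertex_cut S ->
  exists A : {set G}, [/\ [disjoint A & S], 0 < #|A|, 0 < #|~: (S :|: A)|
    & forall u v : G, u \in A -> v \notin S :|: A -> ~~ edge u v].
Proof.
case/forallPn => x /forallPn[y xy]; pose H := del_vertices S.
pose C := [set z : H | connect (@edge H) x z].
exists [set val z | z in C]; split.
- apply/pred0P => u /=; apply/andP => -[/imsetP[z _ ->]].
  by rewrite (negPf (valP z)).
- by apply/card_gt0P; exists (val x); rewrite (mem_imset _ _ val_inj) inE connect0.
- apply/card_gt0P; exists (val y); rewrite !inE negb_or (valP y) /=.
  by rewrite (mem_imset _ _ val_inj) inE.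
move=> _ v /imsetP[z zC ->]; rewrite inE negb_or => /andP[vS vC].
apply: contra vC => zv; rewrite inE in zC.
apply/imsetP; exists (Sub v vS : H) => //; rewrite inE.
by apply: connect_trans zC (connect1 _).
Qed.

(** [G] is not [k.+1]-connected. With more than [k.+2] vertices this yields a cut of size [k]; with
    exactly [k.+2] it yields two non-adjacent vertices, which the other [k] vertices separate. *)
Lemma kappa_separation (n k : nat) (G : sgraph) :
  #|G| = n -> kappa G <= k -> k < n - 1 ->
  exists S A : {set G}, [/\ #|S| = k, [disjoint A & S], 0 < #|A|,
    0 < #|~: (S :|: A)|
    & forall u v : G, u \in A -> v \notin S :|: A -> ~~ edge u v].
Proof.
move=> cardG kappa_le lt_kn.
(* The maximum in [kappa] runs over indices below [#|G|], so [k.+1] must be shown to be one of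
   them. *)
have lt_kG : k.+1 < #|G| by rewrite cardG; lia.
have : ~~ k_connected k.+1 G.
  apply/negP => conn; suff : k < kappa G by rewrite ltnNge kappa_le.
  exact: (leq_bigmax_cond (Ordinal lt_kG) conn).
rewrite /k_connected /= negb_or negb_and => /andP[not_compl no_conn].
have [lt_k2|le_k2] := ltnP k.+2 #|G|.
  move: no_conn; rewrite lt_k2 /= => /forallPn[S].
  rewrite negb_imply negbK subn1 => /andP[/eqP cardS cutS].
  by have [A [dAS A_gt0 B_gt0 noE]] := vertex_cut_separation _ _ cutS; exists S, A.
have cardG2 : #|G| = k.+2 by apply/eqP; rewrite eqn_leq le_k2.
move: not_compl; rewrite cardG2 eqxx => /forallPn[u /forallPn[v]].
rewrite negb_imply => /andP[uv nuv].
exists (~: [set u; v]), [set u]; have cE : ~: (~: [set u; v] :|: [set u]) = [set v].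
  apply/setP => z; rewrite !inE negb_or negbK.
  by have [->|] := eqVneq z u; rewrite /= ?andbT ?andbF // (negPf uv).
split.
- by have := cardsC [set u; v]; rewrite cards2 uv cardG2; lia.
- by rewrite disjoints_subset setCK subsetUl.
- by rewrite cards1.
- by rewrite cE cards1.
move=> x y /set1P->; rewrite -in_setC cE => /set1P->; exact: nuv.
Qed.

(** * The extremal bound for a general [h] *)

Lemma connected_degree_gt0 (G : sgraph) (u : G) :
  connected G -> 1 < #|G| -> 0 < degree u.
Proof.
move=> /forallP/(_ u)/forallP conn cardG.
have /card_gt0P[v] : 0 < #|predC1 u| by rewrite cardC1; lia.
rewrite inE => vu; have /connectP[[|w p] /= pth last_v] := conn v.
  by rewrite last_v eqxx in vu.
by case/andP: pth => uw _; apply/card_gt0P; exists w; rewrite inE.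
Qed.

Lemma degree_prod_max (h : nat -> nat) (n k : nat) (G : sgraph) :
  (forall x, 0 < x -> 0 < h x) ->
  (forall x y, 0 < x -> x < y -> h x < h y) ->
  (forall c a b, 2 <= a <= b ->
    h (c + a) ^ a * h (c + b) ^ b
    < h (c + 1) * h (c + (a + b - 1)) ^ (a + b - 1)) ->
  1 <= k -> k <= n - 1 -> in_V n k G ->
  \prod_(u : G) h (degree u) <= h k * h (n - 1) ^ k * h (n - 2) ^ (n - k - 1)
  /\ (\prod_(u : G) h (degree u)
        = h k * h (n - 1) ^ k * h (n - 2) ^ (n - k - 1)
      <-> sg_iso G (Knk n k)).
Proof.
move=> h_gt0 h_mono h_conv k_gt0 le_kn [connG cardG kappa_le].
have deg_gt0 (u : G) : 0 < degree u.
  by apply: connected_degree_gt0 => //; rewrite cardG; lia.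
suff [le_prod iso_eq] :
  \prod_(u : G) h (degree u) <= h k * h (n - 1) ^ k * h (n - 2) ^ (n - k - 1)
  /\ (\prod_(u : G) h (degree u)
        = h k * h (n - 1) ^ k * h (n - 2) ^ (n - k - 1)
      -> sg_iso G (Knk n k)).
  split=> //; split=> // iso; rewrite (iso_degree_prod _ _ _ iso).
  exact: Knk_degree_prod.
move: le_kn; rewrite leq_eqVlt => /predU1P[eq_k|lt_kn].
  (* For [k = n - 1] the bound is [h (n - 1) ^ n]; equality makes [G] complete, and any vertex can
     serve as the added one. *)
  rewrite eq_k -expnS (_ : (n - 1).+1 = n); last by lia.
  rewrite (_ : n - (n - 1) - 1 = 0) ?muln1; last by lia.
  have cardC1G (u : G) : #|[set~ u]| = n - 1 by rewrite cardsC1 cardG subn1.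
  have sub_nbr (u : G) : [set v | edge u v] \subset [set~ u].
    by apply/subsetP => v; rewrite !inE; apply: contraTneq => ->; rewrite edge_irrefl.
  have le_deg (u : G) : degree u <= n - 1 by rewrite -(cardC1G u) subset_leq_card.
  have prod_n : \prod_(u : G) h (n - 1) = h (n - 1) ^ n.
    by rewrite prod_nat_const cardG.
  rewrite -prod_n; split; first by apply: leq_prod => u _; apply: leq_homo.
  move=> eq_prod; have /card_gt0P[w _] : 0 < #|G| by rewrite cardG; lia.
  have eq_deg (u : G) : degree u = n - 1.
    apply: (homo_inj h h_mono) => //.
    apply: (leq_prod_eq _ (fun u : G => h (degree u)) (fun=> h (n - 1))) => // v.
    - exact: h_gt0.
    - exact: leq_homo.
  apply: (sg_iso_Knk _ _ _ w) => // u v _ _ uv.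
  have /eqP eq_nbr : [set v | edge u v] == [set~ u].
    by rewrite eqEcard sub_nbr cardC1G -(eq_deg u) /=.
  suff : v \in [set v | edge u v] by rewrite inE.
  by rewrite eq_nbr !inE eq_sym.
have [S [A [cardS dAS A_gt0 B_gt0 noE]]] := kappa_separation _ _ _ cardG kappa_le lt_kn.
(* The separation is symmetric, so the sides are exchanged when [A] is the larger one. *)
have [le_AB|lt_BA] := leqP #|A| #|~: (S :|: A)|.
  by apply: (separation_degree_prod h h_gt0 h_mono h_conv n k G S A); rewrite ?A_gt0.
have CBA : ~: (S :|: ~: (S :|: A)) = A.
  apply/setP => z; rewrite !inE negb_or negbK andb_orr andNb /=.
  by rewrite andb_idl // => zA; rewrite (disjointFr dAS).
apply: (separation_degree_prod h h_gt0 h_mono h_conv n k G S (~: (S :|: A))) => //.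
- by rewrite disjoint_sym disjoints_subset setCK subsetUl.
- by rewrite CBA B_gt0 ltnW.
move=> u v; rewrite -[v \notin _]in_setC CBA in_setC => uB vA.
by rewrite edge_sym noE.
Qed.

(** * The two Zagreb indices *)

(** Exchanging the products, [u] contributes [degree u] once per edge containing it. These edges are
    the sets [[set u; v]] for the neighbours [v], all distinct since there are no loops. *)
Lemma zagreb2E (G : sgraph) : zagreb2 G = \prod_(u : G) degree u ^ degree u.
Proof.
rewrite /zagreb2 (exchange_big_dep predT) //=; apply: eq_bigr => u _.
rewrite prod_nat_const; congr (_ ^ _); rewrite /degree.
rewrite -(card_in_imset (_ : {in [set v | edge u v] &, injective (fun v => [set u; v])})).
  apply: eq_card => e; rewrite [LHS]unfold_in; apply/andP/imsetP => [[/imsetP[p]]|[v]].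
    rewrite inE => p_edge -> /set2P[->|->]; first by exists p.2; rewrite ?inE.
    by exists p.1; rewrite ?inE 1?edge_sym // setUC.
  rewrite inE => uv ->; split; last by rewrite set21.
  by apply/imsetP; exists (u, v); rewrite ?inE.
move=> v w; rewrite !inE => uv uw eq_e.
have : v \in [set u; w] by rewrite -eq_e set22.
by case/set2P => // eq_vu; rewrite eq_vu edge_irrefl in uv.
Qed.

Lemma ltn_expn_self (x y : nat) : 0 < x -> x < y -> x ^ x < y ^ y.
Proof.
move=> x_gt0 lt_xy; apply: (@leq_trans (y ^ x)); first by rewrite ltn_exp2r.
by rewrite leq_pexp2l ?(ltnW lt_xy) // (ltn_trans x_gt0).
Qed.

Theorem theorem4p1 (n k : nat) (G : sgraph)
    (k_ge1 : 1 <= k) (k_le : k <= n - 1) (GV : in_V n k G) :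
  (zagreb1 G <= k ^ 2 * (n - 1) ^ (2 * k) * (n - 2) ^ (2 * (n - k - 1))
   /\ (zagreb1 G = k ^ 2 * (n - 1) ^ (2 * k) * (n - 2) ^ (2 * (n - k - 1))
       <-> sg_iso G (Knk n k)))
  /\
  (zagreb2 G <= k ^ k * (n - 1) ^ (k * (n - 1)) * (n - 2) ^ ((n - 2) * (n - k - 1))
   /\ (zagreb2 G = k ^ k * (n - 1) ^ (k * (n - 1)) * (n - 2) ^ ((n - 2) * (n - k - 1))
       <-> sg_iso G (Knk n k))).
Proof.
split.
  rewrite /zagreb1 !expnM; apply: (degree_prod_max (fun x => x ^ 2)) => //.
  - by move=> x x_gt0; rewrite expn_gt0 x_gt0.
  - by move=> x y _; rewrite ltn_sqr.
  (* Swapping the exponents exhibits both sides as squares of those in [expn_convex]. *)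
  move=> c a b le_ab; rewrite !(expnAC _ 2) -!expnMn ltn_sqr.
  exact: expn_convex.
rewrite zagreb2E [k * _]mulnC !expnM; apply: (degree_prod_max (fun x => x ^ x)) => //.
- by move=> x x_gt0; rewrite expn_gt0 x_gt0.
- exact: ltn_expn_self.
exact: expn_self_convex.
Qed.
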